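(* Given a regular inference function $\Psi:\mathcal{X}\times\Theta\to\mathbb{R}^q$, for all $\theta\in\Theta$ and all $z\in\mathcal{Z}$, $$J_\Psi(\theta,z)\le J_{\Psi^I}(\theta,z),$$ where $\le$ is the Löwner partial order of matrices.
   Context: Setting. $\lambda$ is a $\sigma$-finite measure on a measurable space $(\mathcal{X},\mathcal{A})$; $\mathcal{P}^*=\{p(\cdot;\theta,z)=dP_{\theta z}/d\lambda:\theta\in\Theta,\ z\in\mathcal{Z}\}$ is a family of probability densities, $\Theta\subseteq\mathbb{R}^q$ is open, $\mathcal{Z}$ is an arbitrary set, $(\theta,z)\mapsto p(\cdot;\theta,z)$ is a bijection onto $\mathcal{P}^*$, and all densities are strictly positive. $L^2_0(P)$ is the space of $P$-square-integrable functions with $P$-mean zero; $\langle\cdot,\cdot\rangle_{\theta z}$ is the inner product of $L^2(P_{\theta z})$. The partial score function $l(\cdot;\theta,z)=\nabla_\theta p(\cdot;\theta,z)/p(\cdot;\theta,z)=(l_1,\dots,l_q)^T$ is well defined $\lambda$-a.e., $l_i(\cdot;\theta,z)\in L^2_0(P_{\theta z})$, and $l$ is presupposed to satisfy the regularity conditions listed under ''Regular inference function'' below (with $z$ as additional argument). Nuisance tangent space. For $\theta\in\Theta$ let $\mathcal{P}^*_\theta=\{p(\cdot;\theta,z):z\in\mathcal{Z}\}$. The nuisance tangent set $T^0_N(\theta,z)$ is the set of $\nu\in L^2_0(P_{\theta z})$ for which there are a set $V\subseteq[0,\infty)$ containing $0$ and having $0$ as an accumulation point, a path $\{p_t\}_{t\in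 V}\subseteq\mathcal{P}^*_\theta$ and functions $\{r_t\}_{t\in V}\subseteq L^2(P_{\theta z})$ with $p_t=p+tp\nu+tpr_t$ for all $t\in V$, where $p=p(\cdot;\theta,z)$, and $\|r_t\|_{L^2(P_{\theta z})}\to0$ as $t\downarrow0$. $T_N(\theta,z)$ is the $L^2_0(P_{\theta z})$-closure of the linear span of $T_N^0(\theta,z)$, and $T_N^\perp(\theta,z)$ is its orthogonal complement in $L^2_0(P_{\theta z})$. The space $F_{IA}$. For $z,z_*\in\mathcal{Z}$, the $m$-parallel transport of $a\in L^2_0(P_{\theta z_*})$ from $z_*$ to $z$ is $\overset{(m)}{\Pi}{}_{z_*}^{z}a=\frac{p(\cdot;\theta,z_* )}{p(\cdot;\theta,z)}\,a$. Define $F_{IA}(\theta,z)=\{r\in T_N^\perp(\theta,z):\ \langle\overset{(m)}{\Pi}{}_{z_*}^{z}\nu_*,r\rangle_{\theta z}=0\ \text{for all } z_*\in\mathcal{Z},\ \nu_*\in T_N(\theta,z_* )\}$ (it is understood that the transported functions lie in $L^2(P_{\theta z})$, so that the inner products are defined). It is a closed subspace of $L^2_0(P_{\theta z})$, also written $F_{IA}(\theta)$. Regular inference function. $\Psi:\mathcal{X}\times\Theta\to\mathbb{R}^q$, measurable in $x$, with components $\psi_1,\dots,\psi_q$, is a regular inference function if for all $\theta\in\Theta$, $z\in\mathcal{Z}$, $i,j\in\{1,\dots,q\}$: $\psi_i(\cdot;\theta)\in L^2_0(P_{\theta z})$; $\partial\psi_i(\cdot;\theta)/\partial\theta_j$ exists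 almost everywhere; $\frac{\partial}{\partial\theta_j}\int\psi_i(x;\theta)p(x;\theta,z)\lambda(dx)=\int\frac{\partial}{\partial\theta_j}[\psi_i(x;\theta)p(x;\theta,z)]\lambda(dx)$; the $q\times q$ matrix with entries $\mathrm{E}_{\theta z}\{\partial\psi_i(\cdot;\theta)/\partial\theta_j\}$ is well defined and nonsingular; and $\mathrm{E}_{\theta z}\{\Psi(\cdot;\theta)\Psi^T(\cdot;\theta)\}$ is positive definite. Decomposition. The information score function $l^I(\cdot;\theta,z)$ has as $i$-th component $l^I_i$ the orthogonal projection in $L^2_0(P_{\theta z})$ of $l_i(\cdot;\theta,z)$ onto $F_{IA}(\theta)$. Let $E(\theta,z)=\mathrm{span}\{l^I_i(\cdot;\theta,z):i=1,\dots,q\}$. For a function $\Psi$ with components in $L^2_0(P_{\theta z})$, $\Psi^I(\cdot;\theta,z)$ has as $i$-th component $\psi_i^I$ the orthogonal projection of $\psi_i$ onto $E(\theta,z)$. Godambe information. For a (quasi-)inference function $\Psi$ (a function of $x,\theta$ and possibly $z$) with components in $L^2_0(P_{\theta z})$, the (extended) sensitivity is the $q\times q$ matrix $S_\Psi(\theta,z)$ with $(i,j)$ entry $-\langle\psi^I_j,l^I_i\rangle_{\theta z}$; for regular inference functions it coincides with the matrix with $(i,j)$ entry $\mathrm{E}_{\theta z}\{\partial\psi_j/\partial\theta_i\}$. The variability is $V_\Psi(\theta,z)=\mathrm{E}_{\theta z}\{\Psi\Psi^T\}$, and the Godambe information is $J_\Psi(\theta,z)=S_\Psi(\theta,z)V_\Psi^{-1}(\theta,z)S_\Psi^T(\theta,z)$.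 *)

(* Defs.v *)
From HB Require Import structures.
From mathcomp Require Import all_boot all_order all_algebra.
From mathcomp Require Import all_classical all_reals all_analysis.
Set Implicit Arguments.
Unset Strict Implicit.
Unset Printing Implicit Defensive.
Import Order.TTheory GRing.Theory Num.Theory.
Import numFieldNormedType.Exports.
Local Open Scope classical_set_scope.
Local Open Scope ring_scope.

(** Elements of L^2(mu) are represented by functions [X -> R]; equalities
    between them are imposed only almost everywhere, and every set of functions
    introduced below as a subspace of L^2 is meant up to a.e. equality. *)
Section Hilbert.
Context {R : realType} {d : measure_display} {X : measurableType d}.
Implicit Types (mu : {measure set X -> \bar R}) (A : set (X -> R)).

Definition L2 mu : set (X -> R) := [set f | f \in Lfun mu 2%:E].

Definition L20 mu : set (X -> R) := [set f | L2 mu f /\ \int[mu]_x f x = 0].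

Definition L2norm mu (f : X -> R) : \bar R := ('N[mu]_2%:E[EFin \o f])%E.

Definition inner mu (f g : X -> R) : R := \int[mu]_x (f x * g x).

Definition lspan A : set (X -> R) :=
  [set f | exists n (c : 'I_n -> R) (u : 'I_n -> X -> R),
    (forall k, A (u k)) /\ f = (fun x => \sum_(k < n) c k * u k x)].

Definition L20_closure mu A : set (X -> R) :=
  [set f | L20 mu f /\ forall e : R, 0 < e ->
    exists u, [/\ A u, L20 mu u & (L2norm mu (f \- u)%R < e%:E)%E]].

Definition L20_orthogonal mu A : set (X -> R) :=
  [set f | L20 mu f /\ forall g, A g -> inner mu g f = 0].

(** A chosen representative of the orthogonal projection of [f] onto [A]; the
    default value 0 is only taken when no orthogonal projection exists, hence
    never for [f] square integrable and [A] a closed subspace. *)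
Definition orth_proj mu A (f : X -> R) : X -> R :=
  xget (fun=> 0) [set g | A g /\ forall a, A a -> inner mu (f \- g) a = 0].

End Hilbert.

Definition posdef {R : realType} n (A : 'M[R]_n) : Prop :=
  A^T = A /\ forall v : 'rV[R]_n, v != 0 -> 0 < (v *m A *m v^T) 0 0.

Definition possemidef {R : realType} n (A : 'M[R]_n) : Prop :=
  A^T = A /\ forall v : 'rV[R]_n, 0 <= (v *m A *m v^T) 0 0.

Definition loewner_le {R : realType} n (A B : 'M[R]_n) : Prop :=
  possemidef (B - A).

Section Model.
Context {R : realType} {d : measure_display} {X : measurableType d}.
Variables (lambda : {sigma_finite_measure set X -> \bar R}) (q : nat).
Variables (Theta : set 'rV[R]_q) (Z : Type).
(* For [theta] outside [Theta] the values of [P], [p] are irrelevant. *)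
Variables (P : 'rV[R]_q -> Z -> probability X R).
Variables (p : 'rV[R]_q -> Z -> X -> R).

(** [density_inj] compares densities as functions, not up to null sets: this is
    implied by (so weaker than) injectivity into the a.e. classes. *)
Record density_family : Prop := {
  density_open : open Theta;
  density_measurable : forall theta z, Theta theta ->
    measurable_fun setT (p theta z);
  density_gt0 : forall theta z x, Theta theta -> 0 < p theta z x;
  density_RN : forall theta z (A : set X), Theta theta -> measurable A ->
    P theta z A = (\int[lambda]_(x in A) (p theta z x)%:E)%E;
  density_inj : forall theta z theta' z', Theta theta -> Theta theta' ->
    p theta z = p theta' z' -> theta = theta' /\ z = z' }.

(** The sub-family at a fixed value of [theta]. *)
Definition densities_at (theta : 'rV[R]_q) : set (X -> R) := range (p theta).

Definition nuisance_tangent_set (theta : 'rV[R]_q) (z : Z) : set (X -> R) :=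
  [set nu | L20 (P theta z) nu /\
    exists (V : set R) (pt r : R -> X -> R),
      [/\ V `<=` [set t | 0 <= t], V 0 & limit_point V 0] /\
      [/\ forall t, V t -> densities_at theta (pt t),
          forall t, V t -> L2 (P theta z) (r t),
          forall t, V t -> {ae lambda, forall x,
            pt t x = p theta z x + t * p theta z x * nu x
                     + t * p theta z x * r t x} &
          L2norm (P theta z) (r t) @[t --> within V (0^'+)] --> 0%E]].

Definition nuisance_tangent_space (theta : 'rV[R]_q) (z : Z) : set (X -> R) :=
  L20_closure (P theta z) (lspan (nuisance_tangent_set theta z)).

Definition mtransport (theta : 'rV[R]_q) (zs z : Z) (a : X -> R) : X -> R :=
  fun x => p theta zs x / p theta z x * a x.

(** The transported nuisance tangents lie in L^2, so that the inner products
    in the definition of [FIA] below are those of L^2. *)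
Definition transport_L2 : Prop :=
  forall theta zs z nu, Theta theta -> nuisance_tangent_space theta zs nu ->
    L2 (P theta z) (mtransport theta zs z nu).

Definition FIA (theta : 'rV[R]_q) (z : Z) : set (X -> R) :=
  [set r | L20_orthogonal (P theta z) (nuisance_tangent_space theta z) r /\
    forall zs nu, nuisance_tangent_space theta zs nu ->
      inner (P theta z) (mtransport theta zs z nu) r = 0].

(** [D] is a measurable version of the partial derivative at [theta] of the
    family [F], which is required to exist lambda-a.e. only. Whenever the partial
    derivative exists a.e. and [F] is measurable for parameters near [theta],
    a measurable version exists (limit of difference quotients). *)
Definition partial_ae (F : 'rV[R]_q -> X -> R) (theta : 'rV[R]_q) (j : 'I_q)
    (D : X -> R) : Prop :=
  measurable_fun setT D /\
  {ae lambda, forall x,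
    is_derive theta (delta_mx 0 j : 'rV[R]_q) (fun t => F t x : R) (D x)}.

Definition coordf (F : X -> 'rV[R]_q) (i : 'I_q) : X -> R := fun x => F x 0 i.

Definition variability (theta : 'rV[R]_q) (z : Z) (F : X -> 'rV[R]_q)
    : 'M[R]_q :=
  \matrix_(i, j) inner (P theta z) (coordf F i) (coordf F j).

(** Regularity, for functions that may also depend on [z]. *)
Record regular (Psi : 'rV[R]_q -> Z -> X -> 'rV[R]_q) : Prop := {
  regular_L20 : forall theta z i, Theta theta ->
    L20 (P theta z) (coordf (Psi theta z) i);
  regular_interchange : forall theta z i j, Theta theta ->
    exists D : X -> R,
      [/\ partial_ae (fun t x => coordf (Psi t z) i x * p t z x) theta j D,
          lambda.-integrable setT (EFin \o D) &
          is_derive theta (delta_mx 0 j : 'rV[R]_q)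
            (fun t => \int[lambda]_x (coordf (Psi t z) i x * p t z x) : R)
            (\int[lambda]_x D x)];
  regular_sensitivity : forall theta z, Theta theta ->
    exists D : 'I_q -> 'I_q -> X -> R,
      (forall i j, partial_ae (fun t => coordf (Psi t z) i) theta j (D i j) /\
                   (P theta z).-integrable setT (EFin \o D i j)) /\
      (\matrix_(i, j) \int[P theta z]_x D i j x) \in unitmx;
  regular_variability : forall theta z, Theta theta ->
    posdef (variability theta z (Psi theta z)) }.

Definition regular_inference_function (Psi : 'rV[R]_q -> X -> 'rV[R]_q)
    : Prop :=
  regular (fun theta _ => Psi theta).

Definition partial_score (l : 'rV[R]_q -> Z -> X -> 'rV[R]_q) : Prop :=
  (forall theta z, Theta theta ->
    {ae lambda, forall x, forall i,
      let pth := fun t => p t z x : R in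
      derivable pth theta (delta_mx 0 i : 'rV[R]_q) /\
      l theta z x 0 i = 'D_(delta_mx 0 i) pth theta / p theta z x}) /\
  regular l.

Variable l : 'rV[R]_q -> Z -> X -> 'rV[R]_q.

Definition information_score (theta : 'rV[R]_q) (z : Z) : X -> 'rV[R]_q :=
  fun x => \row_i
    orth_proj (P theta z) (FIA theta z) (coordf (l theta z) i) x.

Definition score_span (theta : 'rV[R]_q) (z : Z) : set (X -> R) :=
  lspan (range (coordf (information_score theta z))).

Definition information_part (theta : 'rV[R]_q) (z : Z) (F : X -> 'rV[R]_q)
    : X -> 'rV[R]_q :=
  fun x => \row_i
    orth_proj (P theta z) (score_span theta z) (coordf F i) x.

(** Extended sensitivity; for a regular inference function it equals
    [E (d psi_j / d theta_i)]. *)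
Definition sensitivity (theta : 'rV[R]_q) (z : Z) (F : X -> 'rV[R]_q)
    : 'M[R]_q :=
  \matrix_(i, j) - inner (P theta z)
    (coordf (information_part theta z F) j) (coordf (information_score theta z) i).

(** [invmx] returns its argument on a singular matrix; for a regular inference
    function and for its information part the variability is nonsingular. *)
Definition godambe (theta : 'rV[R]_q) (z : Z) (F : X -> 'rV[R]_q) : 'M[R]_q :=
  sensitivity theta z F *m invmx (variability theta z F)
  *m (sensitivity theta z F)^T.

End Model.

(* Main.v *)
Require Import Defs.
From HB Require Import structures.
From mathcomp Require Import all_boot all_order all_algebra.
From mathcomp Require Import all_classical all_reals all_analysis.
From mathcomp Require Import measurable_realfun ring lra.
Set Implicit Arguments.
Unset Strict Implicit.
Unset Printing Implicit Defensive.
Import Order.TTheory GRing.Theory Num.Theory.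
Import numFieldNormedType.Exports.
Local Open Scope classical_set_scope.
Local Open Scope ring_scope.

(** An inference function [Psi] has mean zero under every nuisance parameter;
    testing this along nuisance paths, and noting that m-parallel transport
    turns an inner product at [z] into one at [zs], shows that its components
    lie in [FIA]. Hence [<psi_i, l_j> = <psi_i, lI_j>], and differentiating
    [\int psi_i p = 0] identifies the matrix [B] of these inner products with
    minus the expected derivative of [Psi], which is nonsingular. So [lI] and
    [PsiI] have nonsingular Gram matrices, [Psi] and [PsiI] share the
    sensitivity [S = - B^T], and [J_PsiI - J_Psi = S (W^-1 - V^-1) S^T] where
    the variabilities satisfy [W <= V] because [PsiI] is a projection of
    [Psi]. The projection onto [FIA] exists by completeness of [L2]. *)

(** * Square integrable functions *)

Section SquareIntegrable.
Context {R : realType} {d : measure_display} {X : measurableType d}.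
Variable mu : {measure set X -> \bar R}.
Implicit Types f g h : X -> R.

Lemma L2_measurable f : L2 mu f -> measurable_fun setT f.
Proof. by move=> /sub_Lfun_mfun; rewrite inE. Qed.

Lemma L2_integrable_mul f g : L2 mu f -> L2 mu g ->
  mu.-integrable setT (EFin \o (fun x => f x * g x)).
Proof. by move=> Lf Lg; apply/Lfun1_integrable; exact: Lfun2_mul_Lfun1. Qed.

Lemma Lnorm2_integrand f :
  (\int[mu]_x `|(EFin \o f) x| `^ 2 = \int[mu]_x (f x ^+ 2)%:E)%E.
Proof.
apply: eq_integral => x _ /=.
by rewrite powR_mulrn// -normrX ger0_norm ?sqr_ge0.
Qed.

Lemma L2P f : measurable_fun setT f ->
  (\int[mu]_x (f x ^+ 2)%:E < +oo)%E -> L2 mu f.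
Proof.
move=> mf f2; rewrite /L2/= inE; apply/andP; split; first by rewrite inE.
rewrite inE/= /finite_norm unlock; apply: poweR_lty.
by rewrite Lnorm2_integrand.
Qed.

Let le12 : (1 <= 2%:E :> \bar R)%E.
Proof. by rewrite lee_fin ler1n. Qed.

Lemma L2D f g : L2 mu f -> L2 mu g -> L2 mu (fun x => f x + g x).
Proof. by move=> Lf Lg; exact: (Lfun_addr_closed mu le12).2 Lf Lg. Qed.

Lemma L2Z a f : L2 mu f -> L2 mu (fun x => a * f x).
Proof.
move=> Lf; rewrite (_ : (fun x => _) = a \o* f).
  by apply: (Lfun_scale _ _ Lf); rewrite ler1n.
by apply/funext => x /=; rewrite mulrC.
Qed.

Lemma L2B f g : L2 mu f -> L2 mu g -> L2 mu (fun x => f x - g x).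
Proof.
move=> Lf Lg; rewrite (_ : (fun x => _) = (fun x => f x + -1 * g x)).
  exact: L2D Lf (L2Z (-1) Lg).
by apply/funext => x; rewrite mulN1r.
Qed.

Lemma L2_0 : L2 mu (fun=> 0).
Proof. exact: (Lfun_addr_closed mu le12).1. Qed.

Lemma L2_sum n (u : 'I_n -> X -> R) :
  (forall k, L2 mu (u k)) -> L2 mu (fun x => \sum_(k < n) u k x).
Proof.
elim: n u => [|n IH] u Lu.
  rewrite (_ : (fun x => _) = fun=> 0); first exact: L2_0.
  by apply/funext => x; rewrite big_ord0.
rewrite (_ : (fun x => _) = fun x => u ord0 x + \sum_(k < n) u (lift ord0 k) x).
  by apply: L2D => //; exact: IH.
by apply/funext => x; rewrite big_ord_recl.
Qed.

Lemma innerC f g : inner mu f g = inner mu g f.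
Proof. by apply: eq_Rintegral => x _; rewrite mulrC. Qed.

Lemma innerDl f g h : L2 mu f -> L2 mu g -> L2 mu h ->
  inner mu (fun x => f x + g x) h = inner mu f h + inner mu g h.
Proof.
move=> Lf Lg Lh; rewrite /inner -RintegralD//; try exact: L2_integrable_mul.
by apply: eq_Rintegral => x _; rewrite mulrDl.
Qed.

Lemma innerBl f g h : L2 mu f -> L2 mu g -> L2 mu h ->
  inner mu (fun x => f x - g x) h = inner mu f h - inner mu g h.
Proof.
move=> Lf Lg Lh; rewrite /inner -RintegralB//; try exact: L2_integrable_mul.
by apply: eq_Rintegral => x _; rewrite mulrBl.
Qed.

Lemma innerZl a f g : L2 mu f -> L2 mu g ->
  inner mu (fun x => a * f x) g = a * inner mu f g.
Proof.
move=> Lf Lg; rewrite /inner -RintegralZl//; try exact: L2_integrable_mul.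
by apply: eq_Rintegral => x _; rewrite mulrA.
Qed.

Lemma inner0l f : inner mu (fun=> 0) f = 0.
Proof.
rewrite /inner (@eq_Rintegral _ _ _ _ _ (cst 0)) ?Rintegral_cst ?mul0r// => x _.
by rewrite mul0r.
Qed.

Lemma inner_suml n (c : 'I_n -> R) (u : 'I_n -> X -> R) g :
  (forall k, L2 mu (u k)) -> L2 mu g ->
  inner mu (fun x => \sum_(k < n) c k * u k x) g =
  \sum_(k < n) c k * inner mu (u k) g.
Proof.
elim: n c u => [|n IH] c u Lu Lg.
  rewrite big_ord0 -[RHS](inner0l g); congr (inner _ _ _).
  by apply/funext => x; rewrite big_ord0.
rewrite big_ord_recl -innerZl// -IH// -innerDl//.
- by congr (inner _ _ _); apply/funext => x; rewrite big_ord_recl.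
- exact: L2Z.
- by apply: L2_sum => k; exact: L2Z.
Qed.

Lemma inner_ge0 f : 0 <= inner mu f f.
Proof. by apply: Rintegral_ge0 => x _; rewrite -expr2 sqr_ge0. Qed.

Lemma innerDD f g : L2 mu f -> L2 mu g ->
  inner mu (fun x => f x + g x) (fun x => f x + g x) =
  inner mu f f + 2 * inner mu f g + inner mu g g.
Proof.
move=> Lf Lg; have Lfg := L2D Lf Lg.
rewrite innerDl// ![inner mu _ (fun x => f x + g x)]innerC !innerDl//.
rewrite (innerC g f); ring.
Qed.

Lemma innerBB f g : L2 mu f -> L2 mu g ->
  inner mu (fun x => f x - g x) (fun x => f x - g x) =
  inner mu f f - 2 * inner mu f g + inner mu g g.
Proof.
move=> Lf Lg; have Lfg := L2B Lf Lg.
rewrite innerBl// ![inner mu _ (fun x => f x - g x)]innerC !innerBl//.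
rewrite (innerC g f); ring.
Qed.

(** The quadratic [t ^+ 2 * a + 2 * t * b + c], the squared norm of [t f + g], is nonnegative for
    every [t], which bounds its discriminant. *)
Lemma inner_CauchySchwarz f g : L2 mu f -> L2 mu g ->
  inner mu f g ^+ 2 <= inner mu f f * inner mu g g.
Proof.
move=> Lf Lg; set a := inner mu f f; set b := inner mu f g.
set c := inner mu g g.
have key (t : R) : 0 <= t ^+ 2 * a + 2 * t * b + c.
  have := inner_ge0 (fun x => t * f x + g x).
  rewrite innerDD//; last exact: L2Z.
  rewrite innerZl//; last exact: L2Z.
  rewrite innerC innerZl// (innerZl t Lf Lg) -/a -/b -/c.
  by congr (0 <= _); ring.
have a0 : 0 <= a := inner_ge0 f.
have [az|an0] := eqVneq a 0.
  have [->|bn0] := eqVneq b 0; first by rewrite az mul0r expr0n.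
  (* For [a = 0] the form is affine in [t], and this [t] is chosen to give it the value -1. *)
  have := key (- (c + 1) / (2 * b)); rewrite az mulr0 add0r.
  have -> : 2 * (- (c + 1) / (2 * b)) * b = - (c + 1) by field.
  lra.
have a_gt0 : 0 < a by rewrite lt_def an0.
(* The minimiser of the quadratic. *)
have := key (- b / a).
have -> : (- b / a) ^+ 2 * a + 2 * (- b / a) * b + c = (a * c - b ^+ 2) / a.
  by field.
by rewrite pmulr_lge0 ?invr_gt0// subr_ge0.
Qed.

(** Replaces the argument that a function of norm zero vanishes a.e.; only its pairings matter
    below. *)
Lemma inner_eq0 f g : L2 mu f -> L2 mu g -> inner mu f f = 0 ->
  inner mu f g = 0.
Proof.
move=> Lf Lg f0; have := inner_CauchySchwarz Lf Lg.
by rewrite f0 mul0r => b0; apply/eqP; rewrite -sqrf_eq0 eq_le b0 sqr_ge0.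
Qed.

(** Links the extended integrals of the convergence theorems to the real-valued [inner]. *)
Lemma integral_sqr_inner f : L2 mu f ->
  (\int[mu]_x (f x ^+ 2)%:E)%E = (inner mu f f)%:E.
Proof.
move=> Lf; rewrite /inner /Rintegral fineK.
  by apply: eq_integral => x _; rewrite expr2.
exact/integrable_fin_num/L2_integrable_mul.
Qed.

Lemma L2norm_sqrt f : L2 mu f -> L2norm mu f = (Num.sqrt (inner mu f f))%:E.
Proof.
move=> Lf; rewrite /L2norm unlock Lnorm2_integrand integral_sqr_inner//.
by rewrite poweR_EFin powR12_sqrt// inner_ge0.
Qed.

Lemma inner_lt_L2norm f (e : R) : 0 < e -> L2 mu f ->
  (L2norm mu f < e%:E)%E -> inner mu f f < e ^+ 2.
Proof.
move=> e0 Lf; rewrite L2norm_sqrt// lte_fin => h.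
rewrite -[ltLHS](sqr_sqrtr (inner_ge0 f)).
by rewrite ltr_pXn2r ?nnegrE ?sqrtr_ge0 ?(ltW e0).
Qed.

End SquareIntegrable.

(** * Completeness and orthogonal projections *)

Section Completeness.
Context {R : realType} {d : measure_display} {X : measurableType d}.
Variable mu : {measure set X -> \bar R}.

(** The increments are absolutely summable: each is at most a geometric term plus its weighted
    square, so [u] converges as a telescoping series. *)
Lemma cvg_of_weighted_sqr (u : nat -> R) (M : R) :
  (forall n, \sum_(k < n) 2 ^+ k * (u k.+1 - u k) ^+ 2 <= M) -> cvgn u.
Proof.
move=> uM; pose v k := u k.+1 - u k.
have sum2 n : \sum_(k < n) (2 ^+ k)^-1 <= 2 :> R.
  suff -> : \sum_(k < n) (2 ^+ k)^-1 = 2 - 2 / 2 ^+ n :> R.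
    by rewrite gerBl divr_ge0// exprn_ge0.
  elim: n => [|n IH]; first by rewrite big_ord0 expr0 divr1 subrr.
  rewrite big_ord_recr/= IH exprS invfM mulrA mulfV ?pnatr_eq0// mul1r; lra.
have vle k : `|v k| <= (2 ^+ k)^-1 + 2 ^+ k * v k ^+ 2.
  have a0 : 0 < 2 ^+ k :> R by rewrite exprn_gt0.
  rewrite -(ler_pM2l a0) mulrDr mulfV ?gt_eqF// mulrA -expr2 -exprMn.
  rewrite -{1}(ger0_norm (ltW a0)) -normrM -[leRHS]addrC -real_normK ?num_real//.
  (* After multiplication by [2 ^+ k] the claim reads [t <= t ^+ 2 + 1]. *)
  have := normr_ge0 (2 ^+ k * v k); move: `|_| => t t0; nra.
have cv : cvgn (series v).
  apply: normed_cvg; rewrite [X in cvgn X](_ : _ = series (fun k => `|v k|))//.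
  apply: nondecreasing_is_cvgn.
    by apply: nondecreasing_series => n _ _; exact: normr_ge0.
  exists (2 + M) => _ [n _ <-]; rewrite seriesEord.
  apply: (@le_trans _ _ (\sum_(k < n) ((2 ^+ k)^-1 + 2 ^+ k * v k ^+ 2))).
    by apply: ler_sum => k _; exact: vle.
  by rewrite big_split; exact: lerD (sum2 n) (uM n).
have -> : u = (fun n => u 0 + series v n).
  by apply/funext => n; rewrite /series/= telescope_sumr// addrC subrK.
by apply: is_cvgD => //; exact: is_cvg_cst.
Qed.

(* The weights [2 ^ n] leave [\sum 2 ^ n |u n.+1 - u n|^2] integrable and, since
   [t <= 2 ^- n + 2 ^ n t ^ 2], dominate [\sum |u n.+1 - u n|] pointwise. *)
Lemma ae_cvg_fast_Cauchy (u : nat -> X -> R) :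
  (forall n, L2 mu (u n)) ->
  (forall n, inner mu (fun x => u n.+1 x - u n x) (fun x => u n.+1 x - u n x)
             <= (2 ^+ n * 2 ^+ n.+1)^-1) ->
  {ae mu, forall x, cvgn (fun n => u n x)}.
Proof.
move=> Lu uC.
pose h n x := (2 ^+ n * (u n.+1 x - u n x) ^+ 2)%:E : \bar R.
have Lv n : L2 mu (fun x => u n.+1 x - u n x) by exact: L2B.
have mv n : measurable_fun setT (fun x => (u n.+1 x - u n x) ^+ 2).
  by apply: measurable_funX; exact: L2_measurable.
have mh n : measurable_fun setT (h n).
  by apply/measurable_EFinP; exact: measurable_funM.
have h0 n x : setT x -> (0 <= h n x)%E.
  by move=> _; rewrite lee_fin mulr_ge0 ?sqr_ge0 ?exprn_ge0.
have ih : (\int[mu]_x (\sum_(n <oo) h n x) <= 1)%E.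
  rewrite integral_nneseries//.
  (* The weight [2 ^+ n] cancels one factor of the assumed rate, leaving the bounds [1 / 2 ^+ n.+1],
     whose sum is at most 1. *)
  have := epsilon_trick0 xpredT (@ler01 R); apply: le_trans.
  apply: lee_nneseries => [n _ _|n _]; first by apply: integral_ge0 => x; exact: h0.
  have -> : (\int[mu]_x h n x =
      (2 ^+ n)%:E * \int[mu]_x ((u n.+1 x - u n x) ^+ 2)%:E)%E.
    rewrite -ge0_integralZl//; first exact/measurable_EFinP.
    by move=> x _; rewrite lee_fin sqr_ge0.
  rewrite integral_sqr_inner// -EFinM lee_fin mul1r natrX.
  rewrite -ler_pdivlMl ?exprn_gt0// -invfM; exact: uC.
have iS : mu.-integrable setT (fun x => (\sum_(n <oo) h n x)%E).
  apply/integrableP; split.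
    by apply: ge0_emeasurable_sum => // k x Dx _; exact: h0.
  under eq_integral => x _.
    rewrite gee0_abs; last by apply: nneseries_ge0 => n _ _; exact: h0.
    over.
  exact: le_lt_trans ih (ltry _).
have := integrable_ae measurableT iS; apply: filterS => x /(_ I) Sx.
apply: (@cvg_of_weighted_sqr _ (fine (\sum_(n <oo) h n x)%E)) => n.
rewrite -lee_fin fineK// -sumEFin -(big_mkord xpredT (fun k => h k x)).
by apply: nneseries_lim_ge => k _ _; exact: h0.
Qed.

(** The limit is taken pointwise off a null set, and Fatou carries the distance bound over to it,
    which also makes it square integrable. The fixed rate suffices because the minimising sequence
    of [L2_projection] is chosen to have it. *)
Lemma L2_complete (u : nat -> X -> R) :
  (forall n, L2 mu (u n)) ->
  (forall n m, (n <= m)%N ->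
     inner mu (fun x => u m x - u n x) (fun x => u m x - u n x)
     <= (2 ^+ n * 2 ^+ n.+1)^-1) ->
  exists2 g, L2 mu g & forall n,
    inner mu (fun x => g x - u n x) (fun x => g x - u n x)
    <= (2 ^+ n * 2 ^+ n.+1)^-1.
Proof.
move=> Lu uC.
have [N [mN N0 subN]] := ae_cvg_fast_Cauchy Lu (fun n => uC n n.+1 (leqnSn n)).
have aeN : {ae mu, forall x, ~ N x} by exists N; split => // x /= /contrapT.
(* Setting the sequence to 0 on the null set [N] makes it converge everywhere, so that its limit is
   measurable. *)
pose u' n x := u n x * \1_(~` N) x.
have cu' x : cvgn (u' ^~ x).
  have [Nx|Nx] := pselect (N x).
    have -> : u' ^~ x = fun=> 0.
      by apply/funext => n; rewrite /u' indicE memNset ?mulr0//; exact.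
    exact: is_cvg_cst.
  have -> : u' ^~ x = u ^~ x.
    by apply/funext => n; rewrite /u' indicE mem_set ?mulr1.
  by apply: contrapT => nc; exact/Nx/subN.
pose g x : R := limn (u' ^~ x).
have mu' n : measurable_fun setT (u' n).
  apply: measurable_funM; first exact: L2_measurable.
  by apply: measurable_indic; exact: measurableC.
have mg : measurable_fun setT g.
  by apply: (measurable_fun_cvg mu') => x _; exact: cu'.
have mgu n : measurable_fun setT (fun x => g x - u n x).
  by apply: measurable_funB => //; exact: L2_measurable.
(* Fatou along the tail of the sequence *)
have gu n : (\int[mu]_x ((g x - u n x) ^+ 2)%:E <= ((2 ^+ n * 2 ^+ n.+1)^-1)%:E)%E.
  pose f m x := ((u' (m + n)%N x - u n x) ^+ 2)%:E : \bar R.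
  have mf m : measurable_fun setT (f m).
    apply/measurable_EFinP; apply: measurable_funX.
    by apply: measurable_funB => //; exact: L2_measurable.
  have f0 m x : setT x -> (0 <= f m x)%E by move=> _; rewrite lee_fin sqr_ge0.
  have -> : (\int[mu]_x ((g x - u n x) ^+ 2)%:E =
             \int[mu]_x limn_einf (f ^~ x))%E.
    apply: eq_integral => x _; apply/esym.
    have cun : (fun m => u' (m + n)%N x - u n x) @ \oo --> g x - u n x.
      apply: cvgB; last exact: cvg_cst.
      by rewrite (cvg_shiftn n (u' ^~ x)); exact: cu'.
    apply: (cvg_limn_einf_sup _).1; apply: cvg_EFin; first exact: nearW.
    rewrite expr2; apply: (cvg_trans _ (cvgM cun cun)).
    by apply: near_eq_cvg; apply: nearW => m /=; rewrite -expr2.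
  apply: le_trans (fatou mu measurableT mf f0) _.
  have fle m : (\int[mu]_x f m x <= ((2 ^+ n * 2 ^+ n.+1)^-1)%:E)%E.
    have Lum : L2 mu (fun x => u (m + n)%N x - u n x) by exact: L2B.
    have -> : (\int[mu]_x f m x = \int[mu]_x ((u (m + n)%N x - u n x) ^+ 2)%:E)%E.
      apply: ge0_ae_eq_integral => //.
      - by apply/measurable_EFinP; apply: measurable_funX; exact: (L2_measurable Lum).
      - by move=> x; exact: f0.
      - by move=> x _; rewrite lee_fin sqr_ge0.
      apply: filterS aeN => x Nx _.
      by rewrite /f /u' indicE mem_set ?mulr1.
    by rewrite integral_sqr_inner// lee_fin uC// leq_addl.
  rewrite limn_einf_lim; apply: lime_le; first exact: is_cvg_einfs.
  apply: nearW => k; apply: le_trans (fle k).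
  by apply: ereal_inf_lbound; exists k => /=.
have Lgu n : L2 mu (fun x => g x - u n x).
  by apply: L2P => //; apply: le_lt_trans (gu n) (ltry _).
exists g.
  have -> : g = fun x => (g x - u 0%N x) + u 0%N x.
    by apply/funext => x; rewrite subrK.
  exact: L2D.
by move=> n; rewrite -lee_fin -integral_sqr_inner.
Qed.

(** A minimising sequence for the distance from [f] to [C] is Cauchy, and the residual at its limit
    is orthogonal to [C]. Closedness is expressed through [inner], in keeping with functions taken
    up to null sets. *)
Lemma L2_projection (C : set (X -> R)) (f : X -> R) :
  C `<=` L2 mu -> C (fun=> 0) ->
  (forall a g h, C g -> C h -> C (fun x => g x + a * h x)) ->
  (forall g, L2 mu g ->
    (forall e, 0 < e -> exists2 h, C h &
       inner mu (fun x => g x - h x) (fun x => g x - h x) < e) -> C g) ->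
  L2 mu f ->
  exists2 g, C g & forall a, C a -> inner mu (fun x => f x - g x) a = 0.
Proof.
move=> CL C0 Clin Ccl Lf.
pose nsq (h : X -> R) := inner mu h h.
pose c n : R := (2 ^+ n * 2 ^+ n.+1)^-1.
have c0 n : 0 < c n by rewrite invr_gt0 mulr_gt0 ?exprn_gt0.
have c_small (K e : R) : 0 <= K -> 0 < e -> exists n, K * c n < e.
  move=> K0 e0; have Ke0 : 0 <= K / e by rewrite divr_ge0// ltW.
  (* With [n] this bound, [K / e < n <= 2 ^ n <= 2 ^ (n + n.+1)]. *)
  exists (Num.bound (K / e)); rewrite ltr_pdivrMr -?exprD ?exprn_gt0//.
  rewrite -ltr_pdivrMl// mulrC; apply: (lt_le_trans (archi_boundP Ke0)).
  set n := Num.bound _; rewrite -natrX ler_nat.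
  by rewrite (leq_trans (ltnW (ltn_expl n (ltnSn 1))))// leq_exp2l// leq_addr.
pose D := [set nsq (fun x => f x - g x) | g in C].
have hD : has_inf D.
  split; first by exists (nsq (fun x => f x - 0)), (fun=> 0).
  by exists 0 => _ [g _ <-]; exact: inner_ge0.
have Dle g : C g -> inf D <= nsq (fun x => f x - g x).
  by move=> Cg; apply: ge_inf; [exact: hD.2|exists g].
(* The slack [c n / 4] is tuned to the parallelogram identity: two such errors give a squared
   distance of at most [c n / 2 + c m / 2]. *)
have : forall n, exists g, C g /\ nsq (fun x => f x - g x) < inf D + c n / 4.
  move=> n; have [|_ [g Cg <-] gD] := inf_adherent _ hD (eps := c n / 4).
    by rewrite divr_gt0.
  by exists g.
move=> /choice[u /all_and2[Cu uD]].
have Lu n : L2 mu (u n) by exact/CL.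
(* parallelogram identity at the midpoint of [u n] and [u m] *)
have uC n m : (n <= m)%N -> nsq (fun x => u m x - u n x) <= c n.
  move=> nm; pose a x := f x - u n x; pose b x := f x - u m x.
  have La : L2 mu a by exact: L2B. have Lb : L2 mu b by exact: L2B.
  have -> : nsq (fun x => u m x - u n x) = nsq (fun x => a x - b x).
    by congr (inner _ _ _); apply/funext => x; rewrite /a /b; ring.
  have hmid : inf D <= nsq (fun x => 2^-1 * (a x + b x)).
    have := Dle _ (Clin (2^-1) _ _ (Clin (2^-1) _ _ C0 (Cu n)) (Cu m)).
    by congr (_ <= inner _ _ _); apply/funext => x; rewrite /a /b; field.
  have Lab := L2D La Lb.
  move: hmid (uD n) (uD m); rewrite -/a -/b /nsq.
  rewrite innerZl//; last exact: L2Z.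
  rewrite innerC innerZl// innerDD// innerBB//.
  have : c m <= c n.
    rewrite lef_pV2 ?posrE ?mulr_gt0 ?exprn_gt0//.
    by rewrite ler_pM ?exprn_ge0// ler_eXn2l// ltr1n.
  move: (c0 n); lra.
have [g Lg gu] := L2_complete Lu uC.
exists g.
  apply: Ccl => // e e0; have [n] := c_small 1 e ler01 e0.
  by rewrite mul1r => ce; exists (u n) => //; exact: le_lt_trans (gu n) ce.
move=> a Ca; have La := CL _ Ca.
(* [f - u n] cannot be shortened by much along [a], at the optimal step
   [b / nsq a] in particular *)
have bn n : inner mu (fun x => f x - u n x) a ^+ 2 <= c n * nsq a.
  have Lfu : L2 mu (fun x => f x - u n x) by exact: L2B.
  have := inner_CauchySchwarz Lfu La.
  rewrite -/(nsq a); have A0 : 0 <= nsq a by exact: inner_ge0.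
  have [->|An0] := eqVneq (nsq a) 0; first by rewrite !mulr0.
  have {}A0 : 0 < nsq a by rewrite lt_def An0.
  move=> _; set b := inner mu _ a.
  have := Dle _ (Clin (b / nsq a) _ _ (Cu n) Ca).
  have -> : (fun x => f x - (u n x + b / nsq a * a x)) =
            (fun x => (f x - u n x) - b / nsq a * a x).
    by apply/funext => x; rewrite opprD addrA.
  rewrite /nsq innerBB//; last exact: L2Z.
  rewrite (innerC _ _ (fun x => b / _ * a x)) innerZl//.
  rewrite (innerZl _ La (L2Z _ La)) (innerC _ a (fun x => b / _ * a x)).
  rewrite innerZl// (innerC _ a) -/b -/(nsq a) -/(nsq (fun x => f x - u n x)).
  have -> : nsq (fun x => f x - u n x) - 2 * (b / nsq a * b) +
     b / nsq a * (b / nsq a * nsq a) =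
     nsq (fun x => f x - u n x) - b ^+ 2 / nsq a by field.
  move=> h; rewrite -ler_pdivrMr//; move: h (uD n) (c0 n); lra.
(* Split the residual at [u n]; the factor 4 comes from
   [(s - t) ^+ 2 <= 2 * s ^+ 2 + 2 * t ^+ 2]. *)
have gn n : inner mu (fun x => f x - g x) a ^+ 2 <= 4 * nsq a * c n.
  have Lfu : L2 mu (fun x => f x - u n x) by exact: L2B.
  have Lgu : L2 mu (fun x => g x - u n x) by exact: L2B.
  have -> : (fun x => f x - g x) = (fun x => (f x - u n x) - (g x - u n x)).
    by apply/funext => x; ring.
  rewrite innerBl//; have h1 := bn n.
  have h2 : inner mu (fun x => g x - u n x) a ^+ 2 <= c n * nsq a.
    apply: (le_trans (inner_CauchySchwarz Lgu La)).
    by rewrite ler_wpM2r ?inner_ge0//; exact: gu.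
  move: h1 h2; set s := inner mu _ a; set t := inner mu _ a => h1 h2.
  have := sqr_ge0 (s + t); nra.
apply/eqP; rewrite -sqrf_eq0 eq_le sqr_ge0 andbT leNgt; apply/negP => h.
have [|n] := c_small (4 * nsq a) _ _ h; first by rewrite mulr_ge0// inner_ge0.
by rewrite ltNge gn.
Qed.

End Completeness.

(** * Gram matrices and the Loewner order *)

Section Loewner.
Context {R : realType} {n : nat}.
Implicit Types V W : 'M[R]_n.

Lemma unitmx_ker0 (A : 'M[R]_n) :
  (forall v : 'rV_n, v *m A = 0 -> v = 0) -> A \in unitmx.
Proof. by move=> A0; rewrite -row_free_unit; exact: inj_row_free. Qed.

(* With [a = u V^-1] and [b = u W^-1], expand [0 <= (a - b) W (a - b)^T] and
   bound [a W a^T] by [a V a^T = u V^-1 u^T]. *)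
Lemma invmx_antimono V W (u : 'rV[R]_n) :
  V^T = V -> W^T = W -> V \in unitmx -> W \in unitmx ->
  (forall v : 'rV_n, 0 <= (v *m W *m v^T) 0 0) ->
  (forall v : 'rV_n, (v *m W *m v^T) 0 0 <= (v *m V *m v^T) 0 0) ->
  (u *m invmx V *m u^T) 0 0 <= (u *m invmx W *m u^T) 0 0.
Proof.
move=> sV sW uV uW W0 WV.
have sVi : (invmx V)^T = invmx V by rewrite trmx_inv sV.
have sWi : (invmx W)^T = invmx W by rewrite trmx_inv sW.
set a := u *m invmx V; set b := u *m invmx W.
have := WV a; have := W0 (a - b).
have bWb : b *m W *m b^T = u *m invmx W *m u^T.
  by rewrite /b mulmxKV// trmx_mul sWi mulmxA.
have aVa : a *m V *m a^T = u *m invmx V *m u^T.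
  by rewrite /a mulmxKV// trmx_mul sVi mulmxA.
have bWa : b *m W *m a^T = u *m invmx V *m u^T.
  by rewrite /b mulmxKV// trmx_mul sVi mulmxA.
have aWb : a *m W *m b^T = u *m invmx V *m u^T.
  by rewrite /b trmx_mul sWi mulmxA mulmxK.
rewrite aVa -/a -/b linearB/= mulmxBl mulmxBl !mulmxBr bWb bWa aWb -/a -/b.
rewrite !mxE; lra.
Qed.

End Loewner.

(** The form in which Cauchy-Schwarz is combined with approximation: [e] bounds the norm of an error
    term, and [A] is the squared norm of a fixed function. *)
Lemma sqr_le_small_eq0 {R : realType} (b A : R) : 0 <= A ->
  (forall e, 0 < e -> b ^+ 2 <= e ^+ 2 * A) -> b = 0.
Proof.
move=> A0 bA; apply/eqP/negPn/negP => b0.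
have A1 : 0 < A + 1 by rewrite ltr_wpDl.
have b2 : 0 < b ^+ 2 by rewrite exprn_even_gt0.
(* For this [e] a nonzero [b] would give [(A + 1) ^+ 2 <= A]; the shift by 1 covers [A = 0]. *)
have := bA (`|b| / (A + 1)) (divr_gt0 _ A1); rewrite normr_gt0 => /(_ b0).
rewrite exprMn real_normK ?num_real// -mulrA ler_pMr// exprVn mulrC.
rewrite ler_pdivlMr ?exprn_gt0//; nra.
Qed.

(** * Gram matrices and projections onto spans and annihilators *)

Section Gram.
Context {R : realType} {d : measure_display} {X : measurableType d}.
Variable mu : {measure set X -> \bar R}.

Definition lcomb n (v : 'rV[R]_n) (u : 'I_n -> X -> R) : X -> R :=
  fun x => \sum_(k < n) v 0 k * u k x.

(** Two families are allowed so that both variabilities and, up to sign and transposition, the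
    sensitivities are instances. *)
Definition gram m n (u : 'I_m -> X -> R) (w : 'I_n -> X -> R) : 'M[R]_(m, n) :=
  \matrix_(i, j) inner mu (u i) (w j).

Lemma L2_lcomb n (v : 'rV[R]_n) u : (forall k, L2 mu (u k)) -> L2 mu (lcomb v u).
Proof. by move=> Lu; apply: L2_sum => k; exact: L2Z. Qed.

Lemma inner_lcombl n (v : 'rV[R]_n) u m (w : 'I_m -> X -> R) j :
  (forall k, L2 mu (u k)) -> L2 mu (w j) ->
  inner mu (lcomb v u) (w j) = (v *m gram u w) 0 j.
Proof.
move=> Lu Lw; rewrite /lcomb inner_suml// mxE.
by apply: eq_bigr => k _; rewrite mxE.
Qed.

(** Turns quadratic forms of Gram matrices into squared norms, so that positivity of matrices
    follows from [inner_ge0]. *)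
Lemma inner_lcomb m n (v : 'rV[R]_m) u (v' : 'rV[R]_n) w :
  (forall k, L2 mu (u k)) -> (forall k, L2 mu (w k)) ->
  inner mu (lcomb v u) (lcomb v' w) = (v *m gram u w *m v'^T) 0 0.
Proof.
move=> Lu Lw; rewrite innerC {1}/lcomb inner_suml//; last exact: L2_lcomb.
rewrite mxE; apply: eq_bigr => k _.
by rewrite innerC inner_lcombl// [v'^T _ _]mxE mulrC.
Qed.

Lemma tr_gram m n (u : 'I_m -> X -> R) (w : 'I_n -> X -> R) :
  (gram u w)^T = gram w u.
Proof. by apply/matrixP => i j; rewrite !mxE innerC. Qed.

(** A vector [v] in the kernel of [gram u u] gives a combination of norm zero; it is orthogonal to
    every [w j], so [v] also kills the invertible [gram u w]. *)
Lemma gram_unitmx n (u w : 'I_n -> X -> R) :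
  (forall k, L2 mu (u k)) -> (forall k, L2 mu (w k)) ->
  gram u w \in unitmx -> gram u u \in unitmx.
Proof.
move=> Lu Lw uw; apply: unitmx_ker0 => v v0.
have h0 : inner mu (lcomb v u) (lcomb v u) = 0.
  by rewrite inner_lcomb// v0 mul0mx mxE.
rewrite -[v](mulmxK uw) -[RHS](mul0mx _ (invmx (gram u w))); congr (_ *m _).
apply/rowP => j; rewrite -inner_lcombl// [RHS]mxE.
by apply: inner_eq0 => //; exact: L2_lcomb.
Qed.

Lemma lspan_range_L2 n (u : 'I_n -> X -> R) a :
  (forall k, L2 mu (u k)) -> lspan (range u) a -> L2 mu a.
Proof.
move=> Lu [m [c [w [wu ->]]]]; apply: L2_sum => k; apply: L2Z.
by have [i _ <-] := wu k.
Qed.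

Lemma inner_lspan (A : set (X -> R)) f a : A `<=` L2 mu -> L2 mu f ->
  (forall u, A u -> inner mu u f = 0) -> lspan A a -> inner mu a f = 0.
Proof.
move=> AL Lf Af [m [c [w [wA ->]]]].
rewrite inner_suml//; last by move=> k; exact/AL.
by apply: big1 => k _; rewrite Af ?mulr0.
Qed.

(** The existence of a projection rules out the default value in the choice made by [orth_proj]. *)
Lemma orth_projP (A : set (X -> R)) f :
  (exists2 g, A g & forall a, A a -> inner mu (fun x => f x - g x) a = 0) ->
  A (orth_proj mu A f) /\
  forall a, A a -> inner mu (fun x => f x - orth_proj mu A f x) a = 0.
Proof.
move=> [g Ag fg]; rewrite /orth_proj.
by apply: (@xgetPex _ (fun=> 0)
  [set g | A g /\ forall a, A a -> inner mu (f \- g) a = 0]); exists g.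
Qed.

Lemma inner_orth_proj (A : set (X -> R)) f a :
  A `<=` L2 mu -> L2 mu f -> A a ->
  (exists2 g, A g & forall a, A a -> inner mu (fun x => f x - g x) a = 0) ->
  inner mu (orth_proj mu A f) a = inner mu f a.
Proof.
move=> AL Lf Aa /orth_projP[/AL Lg /(_ _ Aa)]; have La := AL _ Aa.
by rewrite innerBl// => /eqP; rewrite subr_eq0 => /eqP.
Qed.

(** The coefficients [b *m invmx (gram u u)] solve the normal equations. *)
Lemma lspan_range_projection n (u : 'I_n -> X -> R) f :
  (forall k, L2 mu (u k)) -> gram u u \in unitmx -> L2 mu f ->
  exists2 g, lspan (range u) g &
    forall a, lspan (range u) a -> inner mu (fun x => f x - g x) a = 0.
Proof.
move=> Lu uG Lf; pose b : 'rV[R]_n := \row_j inner mu f (u j).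
pose g := lcomb (b *m invmx (gram u u)) u.
have Lg : L2 mu g by exact: L2_lcomb.
exists g; first by exists n, (fun k => (b *m invmx (gram u u)) 0 k), u.
move=> a ua; rewrite innerC; apply: inner_lspan ua.
- by move=> _ [k _ <-].
- exact: L2B.
- move=> _ [k _ <-]; rewrite innerC innerBl// inner_lcombl//.
  by rewrite mulmxKV// mxE subrr.
Qed.

(** The annihilator of any subset of L^2 is a subspace, closed because Cauchy-Schwarz makes each
    pairing continuous. *)
Lemma orthogonal_projection (G : set (X -> R)) f : G `<=` L2 mu -> L2 mu f ->
  let C := [set g | L2 mu g /\ forall k, G k -> inner mu k g = 0] in
  exists2 g, C g & forall a, C a -> inner mu (fun x => f x - g x) a = 0.
Proof.
move=> GL Lf C; apply: L2_projection => //.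
- by move=> g [].
- by split=> [|k _]; [exact: L2_0 | rewrite innerC inner0l].
- move=> a g h [Lg Gg] [Lh Gh]; have Lah := L2Z a Lh; split; first exact: L2D.
  move=> k Gk; have Lk := GL _ Gk.
  by rewrite innerC innerDl// innerZl// ![inner mu _ k]innerC Gg// Gh// mulr0 addr0.
- move=> g Lg gC; split=> // k Gk; have Lk := GL _ Gk.
  apply: (@sqr_le_small_eq0 _ _ (inner mu k k)); first exact: inner_ge0.
  move=> e e0; have [h [Lh Gh] gh] := gC _ (exprn_gt0 2 e0).
  have Lgh : L2 mu (fun x => g x - h x) by exact: L2B.
  have -> : inner mu k g = inner mu (fun x => g x - h x) k.
    by rewrite innerBl// ![inner mu _ k]innerC Gh// subr0.
  apply: le_trans (inner_CauchySchwarz Lgh Lk) _.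
  by rewrite ler_wpM2r ?inner_ge0// ltW.
Qed.

End Gram.

(** * Inference functions *)

Section ChangeOfDensity.
Context {R : realType} {d : measure_display} {X : measurableType d}.
Variables (lambda : {sigma_finite_measure set X -> \bar R}).
Variables (P : probability X R) (g : X -> R).
Hypothesis mg : measurable_fun setT g.
Hypothesis g_gt0 : forall x, 0 < g x.
Hypothesis PE : forall A, measurable A ->
  P A = (\int[lambda]_(x in A) (g x)%:E)%E.

Lemma density_dominates : P `<< lambda.
Proof.
move=> A A0 B mB BA; rewrite PE//; apply: null_set_integral => //.
  by apply/measurable_EFinP; exact: measurable_funTS.
exact: A0.
Qed.

(** [g] agrees a.e. with the Radon-Nikodym derivative of [P], since both integrate to [P] on every
    measurable set. *)
Lemma ge0_integral_density (f : X -> \bar R) :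
  measurable_fun setT f -> (forall x, (0 <= f x)%E) ->
  (\int[P]_x f x = \int[lambda]_x (f x * (g x)%:E))%E.
Proof.
move=> mf f0; have Pl := density_dominates.
pose r := Radon_Nikodym_SigmaFinite.f P lambda.
have ir : lambda.-integrable setT r.
  exact: Radon_Nikodym_SigmaFinite.f_integrable.
have rg : ae_eq lambda setT r (EFin \o g).
  apply: integral_ae_eq => //; first exact/measurable_EFinP.
  move=> E _ mE; rewrite -[RHS]PE//; apply/esym.
  exact: (Radon_Nikodym_SigmaFinite.f_integral Pl).
rewrite -(Radon_Nikodym_SigmaFinite.change_of_variables Pl)//.
apply: ge0_ae_eq_integral => //.
- by apply: emeasurable_funM => //; exact: measurable_int ir.
- by apply: emeasurable_funM => //; exact/measurable_EFinP.
- by move=> x _; rewrite mule_ge0// Radon_Nikodym_SigmaFinite.f_ge0.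
- by move=> x _; rewrite mule_ge0// lee_fin ltW.
- by apply: filterS rg => x /[apply]; rewrite -/r => ->.
Qed.

Lemma integral_density (f : X -> \bar R) : measurable_fun setT f ->
  (\int[P]_x f x = \int[lambda]_x (f x * (g x)%:E))%E.
Proof.
move=> mf; rewrite integralE [RHS]integralE.
rewrite !ge0_integral_density//.
- congr (_ - _)%E; apply: eq_integral => x _.
    by rewrite !funeposE maxe_pMl ?mul0e ?lee_fin ?ltW.
  by rewrite !funenegE -mulNe maxe_pMl ?mul0e ?lee_fin ?ltW.
- exact: measurable_funeneg.
- exact: measurable_funepos.
Qed.

Lemma Rintegral_density (f : X -> R) : measurable_fun setT f ->
  \int[P]_x f x = \int[lambda]_x (f x * g x).
Proof.
by move=> mf; rewrite /Rintegral integral_density//; exact/measurable_EFinP.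
Qed.

End ChangeOfDensity.

(** * Unbiased functions, the space [FIA] and the score *)

Section Model.
Context {R : realType} {d : measure_display} {X : measurableType d}.
Context {lambda : {sigma_finite_measure set X -> \bar R}} {q : nat}.
Context {Theta : set 'rV[R]_q} {Z : Type}.
Context {P : 'rV[R]_q -> Z -> probability X R}.
Context {p : 'rV[R]_q -> Z -> X -> R}.
Hypothesis dens : density_family lambda Theta P p.

Let mp theta z : Theta theta -> measurable_fun setT (p theta z).
Proof. by move=> Th; exact: (density_measurable dens). Qed.

Let p_gt0 theta z : Theta theta -> forall x, 0 < p theta z x.
Proof. by move=> Th x; exact: (density_gt0 dens). Qed.

Let PE theta z : Theta theta -> forall A, measurable A ->
  P theta z A = (\int[lambda]_(x in A) (p theta z x)%:E)%E.
Proof. by move=> Th A mA; exact: (density_RN dens). Qed.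

Let intP theta z (f : X -> R) : Theta theta -> measurable_fun setT f ->
  \int[P theta z]_x f x = \int[lambda]_x (f x * p theta z x).
Proof.
by move=> Th; apply: Rintegral_density; [exact: mp|exact: p_gt0|exact: PE].
Qed.

Hypothesis transp : transport_L2 lambda Theta P p.

Section FixedTheta.
Context {theta : 'rV[R]_q} (Th : Theta theta).
Variable h : X -> R.
Hypothesis h0 : forall z, L20 (P theta z) h.

Let Lh z : L2 (P theta z) h. Proof. by have [] := h0 z. Qed.
Let mh (z : Z) : measurable_fun setT h. Proof. exact: L2_measurable (Lh z). Qed.

(** Integrating [h] against [p_t = p + t p nu + t p r_t] gives 0, as does integrating it against
    [p]. Dividing the difference by [t] leaves [<nu, h> = - <r_t, h>], which tends to 0 with the
    norm of [r_t]. *)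
Lemma inner_nuisance_tangent_set z nu :
  nuisance_tangent_set lambda P p theta z nu -> inner (P theta z) nu h = 0.
Proof.
move=> [[Lnu _] [V [pt [r [[V0 _ Vlim] [pt_in Lr ptE r_cvg]]]]]].
pose A := inner (P theta z) h h.
apply: (@sqr_le_small_eq0 _ _ A); first exact: inner_ge0.
move=> e e0.
(* A limit point supplies some [t] in [V] other than 0; it is positive because [V] is contained in
   the nonnegative reals. *)
have [t [Vt t_gt0 rt]] : exists t, [/\ V t, 0 < t &
    (L2norm (P theta z) (r t) < e%:E)%E].
  have : \forall t \near within V (0^'+ : set_system R),
      (L2norm (P theta z) (r t) < e%:E)%E.
    apply: (r_cvg [set y | (y < e%:E)%E]); exact: lt_nbhsl.
  rewrite /within/= => -[dl /= dl0 rdl].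
  have [t [t0 Vt tdl]] := Vlim _ (nbhsx_ballx (0 : R) dl dl0).
  have t_gt0 : 0 < t by rewrite lt_def t0; exact: V0.
  by exists t; split => //; exact: rdl.
have [zt _ ptz] := pt_in t Vt.
have Lrt := Lr t Vt.
have mnu := L2_measurable Lnu; have mr := L2_measurable Lrt.
have mhz := mh z.
(* This is [h * p_t / p] a.e., so its mean at [z] is the mean of [h] at the nuisance value [zt] of
   the path. *)
pose k x := h x + t * (nu x * h x + r t x * h x).
have mk : measurable_fun setT k.
  apply: measurable_funD => //; apply: measurable_funM => //.
  by apply: measurable_funD; exact: measurable_funM.
have k0 : \int[P theta z]_x k x = 0.
  have [_ <-] := h0 zt; rewrite !intP//; congr fine; apply: ae_eq_integral => //.
  - by apply/measurable_EFinP; apply: measurable_funM => //; exact: mp.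
  - by apply/measurable_EFinP; apply: measurable_funM => //; exact: mp.
  - apply: filterS (ptE t Vt) => x ptx _ /=; congr EFin.
    by rewrite ptz ptx /k; ring.
have inuh := L2_integrable_mul Lnu (Lh z).
have irh := L2_integrable_mul Lrt (Lh z).
have inr : (P theta z).-integrable setT
    (EFin \o (fun x => nu x * h x + r t x * h x)).
  exact: (integrableD measurableT inuh irh).
have ih : (P theta z).-integrable setT (EFin \o h).
  apply/Lfun1_integrable; apply: Lfun_subset12; last exact: Lh.
  exact: fin_num_measure.
have : inner (P theta z) nu h = - inner (P theta z) (r t) h.
  move: k0; rewrite /k RintegralD//; last exact: (integrableZl measurableT t inr).
  have [_ ->] := h0 z; rewrite add0r RintegralZl// RintegralD//.
  move/eqP; rewrite mulf_eq0 gt_eqF//= addr_eq0 => /eqP; exact.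
move=> ->; rewrite sqrrN; apply: le_trans (inner_CauchySchwarz Lrt (Lh z)) _.
by rewrite ler_wpM2r ?inner_ge0// ltW// inner_lt_L2norm.
Qed.

(** Orthogonality passes to the span by linearity and to its closure by Cauchy-Schwarz. *)
Lemma inner_nuisance_tangent_space z nu :
  nuisance_tangent_space lambda P p theta z nu -> inner (P theta z) nu h = 0.
Proof.
move=> [[Lnu _] nucl].
apply: (@sqr_le_small_eq0 _ _ (inner (P theta z) h h)); first exact: inner_ge0.
move=> e /[dup] e0 /nucl[u [uspan [Lu _] nu_u]].
have Lnuu : L2 (P theta z) (fun x => nu x - u x) by exact: L2B.
have u0 : inner (P theta z) u h = 0.
  apply: inner_lspan uspan => //; first by move=> v [[]].
  by move=> v; exact: inner_nuisance_tangent_set.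
have -> : inner (P theta z) nu h = inner (P theta z) (fun x => nu x - u x) h.
  by rewrite innerBl// u0 subr0.
apply: le_trans (inner_CauchySchwarz Lnuu (Lh z)) _.
by rewrite ler_wpM2r ?inner_ge0// ltW// inner_lt_L2norm.
Qed.

(* Transport only changes the reference measure:
   [<Pi nu, h>_z = <nu, h>_zs]. *)
Lemma unbiased_FIA z : FIA lambda P p theta z h.
Proof.
split; first by split=> // nu; exact: inner_nuisance_tangent_space.
move=> zs nu nuT; rewrite -(inner_nuisance_tangent_space nuT).
have mnu : measurable_fun setT nu by have [[/L2_measurable]] := nuT.
have mpz := mp z Th; have mpzs := mp zs Th; have mhz := mh z.
rewrite /inner !intP//.
- apply: eq_Rintegral => x _; rewrite /mtransport.
  by have /gt_eqF/negbT pz := p_gt0 z Th x; field.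
- exact: measurable_funM.
- by apply: measurable_funM => //; apply: L2_measurable (transp _ Th nuT).
Qed.

End FixedTheta.

(** [FIA] is the annihilator of a set [G] of square integrable functions, so the projection
    exists. *)
Lemma FIA_projection theta z f : Theta theta -> L2 (P theta z) f ->
  exists2 g, FIA lambda P p theta z g &
    forall a, FIA lambda P p theta z a ->
      inner (P theta z) (fun x => f x - g x) a = 0.
Proof.
(* The constant 1 encodes the mean-zero condition; the transported tangents lie in L^2 by
   [transp]. *)
move=> Th Lf; pose G : set (X -> R) := [set k | k = cst 1 \/
  nuisance_tangent_space lambda P p theta z k \/
  exists zs nu, nuisance_tangent_space lambda P p theta zs nu /\
    k = mtransport p theta zs z nu].
have GL : G `<=` L2 (P theta z).
  move=> _ [->|[[[]]//|[zs [nu [nuT ->]]]]]; first exact: Lfun_cst.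
  exact: transp.
have FE : FIA lambda P p theta z =
    [set g | L2 (P theta z) g /\ forall k, G k -> inner (P theta z) k g = 0].
  have inner1 g : inner (P theta z) (cst 1) g = \int[P theta z]_x g x.
    by apply: eq_Rintegral => x _; rewrite mul1r.
  apply/seteqP; split => g.
    move=> [[[Lg g0] gT] gP]; split => // k [->|[kT|[zs [nu [nuT ->]]]]].
    - by rewrite inner1.
    - exact: gT.
    - exact: gP.
  move=> [Lg gG]; split.
    split; first by split => //; rewrite -inner1; apply: gG; left.
    by move=> k kT; apply: gG; right; left.
  by move=> zs nu nuT; apply: gG; right; right; exists zs, nu.
rewrite FE; exact: orthogonal_projection.
Qed.

Lemma FIA_L2 theta z : FIA lambda P p theta z `<=` L2 (P theta z).
Proof. by move=> f [[[]]]. Qed.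

(* Differentiate [\int Psi p = 0] under the integral sign. *)
Lemma expected_derivative_score l Psi theta z i j D :
  Theta theta -> partial_score lambda Theta P p l ->
  regular_inference_function lambda Theta P p Psi ->
  partial_ae lambda (fun t => coordf (Psi t) i) theta j D ->
  (P theta z).-integrable setT (EFin \o D) ->
  \int[P theta z]_x D x =
  - inner (P theta z) (coordf (Psi theta) i) (coordf (l theta z) j).
Proof.
move=> Th [lE rl] rPsi [mD DE] iD.
have [D' [[mD' D'E] iD' intD']] := regular_interchange rPsi z i j Th.
have Lpsi : L2 (P theta z) (coordf (Psi theta) i).
  by have [] := regular_L20 rPsi z i Th.
have Ll : L2 (P theta z) (coordf (l theta z) j).
  by have [] := regular_L20 rl z j Th.
(* As [Theta] is open, the mean of [Psi] vanishes on a neighbourhood of [theta], hence so does its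
   derivative at [theta]. *)
have int0 : \int[lambda]_x D' x = 0.
  rewrite -(@derive_val _ _ _ _ _ _ _ intD').
  have -> : 0 = 'D_(delta_mx 0 j : 'rV[R]_q) (cst (0 : R)) theta.
    by rewrite derive_cst.
  apply: near_eq_derive.
  have := open_nbhs_nbhs (conj (density_open dens) Th).
  apply: filterS => t Tt.
  have [Lt0 t0] := regular_L20 rPsi z i Tt.
  by rewrite -intP//; exact: L2_measurable Lt0.
(* By the product rule [D' = k * p] a.e., the score being the derivative of [p] divided by [p]. *)
pose k x := coordf (Psi theta) i x * coordf (l theta z) j x + D x.
have ipl := L2_integrable_mul Lpsi Ll.
have mk : measurable_fun setT k.
  apply: measurable_funD => //; apply: measurable_funM.
    exact: L2_measurable Lpsi.
  exact: L2_measurable Ll.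
have : \int[P theta z]_x k x = 0.
  rewrite intP// -[RHS]int0; congr fine; apply: ae_eq_integral => //.
  - by apply/measurable_EFinP; apply: measurable_funM => //; exact: mp.
  - exact/measurable_EFinP.
  - have := lE theta z Th; apply: filterS3 DE D'E => x Dx D'x lx _ /=.
    have [dp lp] := lx j.
    have dpx := derivableP dp.
    have := @derive_val _ _ _ _ _ _ _ (is_deriveM Dx dpx).
    have -> : ((fun t => coordf (Psi t) i x : R) * (fun t => p t z x : R))
      = (fun t => coordf (Psi t) i x * p t z x) by [].
    rewrite (@derive_val _ _ _ _ _ _ _ D'x) => ->; congr EFin.
    rewrite /k {2}/coordf lp /GRing.scale/=.
    by have /gt_eqF/negbT pz := p_gt0 z Th x; field.
rewrite RintegralD// => /eqP; rewrite addrC addr_eq0 => /eqP; exact.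
Qed.

End Model.

Theorem proposition15 (R : realType) (d : measure_display)
    (X : measurableType d) (lambda : {sigma_finite_measure set X -> \bar R})
    (q : nat) (Theta : set 'rV[R]_q) (Z : Type)
    (P : 'rV[R]_q -> Z -> probability X R)
    (p : 'rV[R]_q -> Z -> X -> R)
    (l : 'rV[R]_q -> Z -> X -> 'rV[R]_q)
    (Psi : 'rV[R]_q -> X -> 'rV[R]_q) :
  density_family lambda Theta P p ->
  transport_L2 lambda Theta P p ->
  partial_score lambda Theta P p l ->
  regular_inference_function lambda Theta P p Psi ->
  forall (theta : 'rV[R]_q) (z : Z), Theta theta ->
    loewner_le
      (godambe lambda P p l theta z (Psi theta))
      (godambe lambda P p l theta z
        (information_part lambda P p l theta z (Psi theta))).
Proof.
move=> dens transp score rPsi theta z Th.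
set mu := P theta z.
pose psi := coordf (Psi theta).
pose lI := coordf (information_score lambda P p l theta z).
pose psiI := coordf (information_part lambda P p l theta z (Psi theta)).
pose E := lspan (range lI).
have Lpsi i : L2 mu (psi i) by have [] := regular_L20 rPsi z i Th.
have Ll i : L2 mu (coordf (l theta z) i).
  by have [] := regular_L20 score.2 z i Th.
have lIE i : lI i = orth_proj mu (FIA lambda P p theta z) (coordf (l theta z) i).
  by apply/funext => x; rewrite /lI /coordf mxE.
have psiIE F i : coordf (information_part lambda P p l theta z F) i =
    orth_proj mu E (coordf F i).
  by apply/funext => x; rewrite /coordf mxE.
have LlI i : L2 mu (lI i).
  rewrite lIE; apply: (@FIA_L2 _ _ _ lambda _ _ P p).
  by have [] := orth_projP (FIA_projection transp Th (Ll i)).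
have psi_FIA i : FIA lambda P p theta z (psi i).
  apply: (unbiased_FIA dens transp Th) => z'.
  exact: (regular_L20 rPsi z' i Th).
(* Since each [psi i] lies in [FIA], replacing [l] by its projection [lI] leaves the pairings
   unchanged, so this matrix is minus that of the expected derivatives. *)
have B_unit : gram mu psi lI \in unitmx.
  have [D [DE]] := regular_sensitivity rPsi z Th.
  suff -> : \matrix_(i, j) \int[P theta z]_x D i j x = - gram mu psi lI.
    by rewrite -scaleN1r unitmxZ// unitrN1.
  apply/matrixP => i j; have [Dij iD] := DE i j; rewrite !mxE.
  rewrite (expected_derivative_score dens Th score rPsi Dij iD); congr (- _).
  rewrite innerC [RHS]innerC lIE inner_orth_proj//; first exact: FIA_L2.
  exact (FIA_projection transp Th (Ll j)).
have G_unit : gram mu lI lI \in unitmx.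
  by apply: (gram_unitmx LlI Lpsi); rewrite -tr_gram unitmx_tr.
have EL : E `<=` L2 mu by move=> a; exact: lspan_range_L2.
have Eproj f : L2 mu f -> exists2 g, E g &
    forall a, E a -> inner mu (fun x => f x - g x) a = 0.
  exact: lspan_range_projection.
have ElI i : E (lI i).
  exists 1%N, (fun=> 1), (fun=> lI i); split; first by exists i.
  by apply/funext => x; rewrite big_ord1 mul1r.
have EpsiI i : E (psiI i).
  by rewrite /psiI psiIE; have [] := orth_projP (Eproj _ (Lpsi i)).
have LpsiI i : L2 mu (psiI i) by exact/EL.
have inner_psiI i a : E a -> inner mu (psiI i) a = inner mu (psi i) a.
  by move=> Ea; rewrite /psiI psiIE inner_orth_proj//; exact: Eproj.
(* Projecting onto [E] preserves pairings with [lI], so the sensitivity can be read off [F] itself,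
   for [Psi] and for its information part alike. *)
have S_E F : (forall i, L2 mu (coordf F i)) ->
    sensitivity lambda P p l theta z F = - (gram mu (coordf F) lI)^T.
  move=> LF; apply/matrixP => i j; rewrite !mxE psiIE inner_orth_proj//.
  exact: Eproj.
have BE : gram mu psiI lI = gram mu psi lI.
  by apply/matrixP => i j; rewrite !mxE inner_psiI.
set V := variability P theta z (Psi theta).
set W := variability P theta z (information_part lambda P p l theta z (Psi theta)).
have V_gram : V = gram mu psi psi by [].
have W_gram : W = gram mu psiI psiI by [].
have V_unit : V \in unitmx.
  apply: unitmx_ker0 => v vV; apply/eqP/negPn/negP => v0.
  have [_ /(_ v v0)] := regular_variability rPsi z Th.
  by rewrite -/V vV mul0mx mxE ltxx.
have W_unit : W \in unitmx.
  by rewrite W_gram; apply: (gram_unitmx LpsiI LlI); rewrite BE.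
have VT : V^T = V by rewrite V_gram tr_gram.
have WT : W^T = W by rewrite W_gram tr_gram.
have W_ge0 (v : 'rV_q) : 0 <= (v *m W *m v^T) 0 0.
  by have := inner_ge0 mu (lcomb v psiI); rewrite inner_lcomb// W_gram.
(* The residual combination has squared norm [v V v^T - 2 v W v^T + v W v^T]: the cross term is also
   governed by [W], because each [psiI j] lies in [E]. *)
have WV (v : 'rV_q) : (v *m W *m v^T) 0 0 <= (v *m V *m v^T) 0 0.
  have := inner_ge0 mu (fun x => lcomb v psi x - lcomb v psiI x).
  rewrite innerBB; [|exact: L2_lcomb..].
  rewrite !inner_lcomb// -V_gram -W_gram.
  have -> : gram mu psi psiI = W.
    by apply/matrixP => i j; rewrite !mxE -inner_psiI.
  lra.
rewrite /loewner_le /godambe !S_E// BE -/psi -/V -/W.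
set S := - _; split.
  rewrite linearB/= !trmx_mul !trmxK !trmx_inv VT WT.
  by rewrite !mulmxA.
move=> u; rewrite mulmxBr mulmxBl.
(* Absorbing [S] into the row vector reduces the claim to antimonotonicity of the inverse, tested at
   [u *m S]. *)
have uSE A : u *m (S *m A *m S^T) *m u^T = (u *m S) *m A *m (u *m S)^T.
  by rewrite trmx_mul !mulmxA.
rewrite !uSE [X in 0 <= X]mxE [X in _ + X]mxE subr_ge0.
exact: invmx_antimono.
Qed.
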